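(* Let $A$ be a BP*-algebra with identity $e$. Let $P_{1}(A)$ be the set of all positive linear functionals $f$ on $A$ with $f(e)=1$, and let $M_{s}(A)$ be the set of all nonzero hermitian multiplicative linear functionals on $A$. Then the set of extreme points of the convex set $P_{1}(A)$ is exactly $M_{s}(A)$.
   Context: A topological algebra is an algebra over $\mathbb{C}$ which is also a Hausdorff topological vector space such that the multiplication is separately continuous; a locally convex algebra is a topological algebra whose topology is locally convex. Let $A$ be a commutative locally convex algebra with identity $e$ and with a continuous involution $x\mapsto x^{\ast}$. Let $\beta$ be the family of all subsets $B\subset A$ that are closed, bounded, absolutely convex, contain $e$, hermitian ($B^{\ast}=B$) and idempotent ($BB\subset B$). For $B\in\beta$, let $A_{B}$ be the linear span of $B$, a *-subalgebra of $A$ which is a normed *-algebra with identity and isometric involution when equipped with the Minkowski functional $\Vert\cdot\Vert_{B}$ of $B$. $A$ is called a BP*-algebra if $A=\bigcup\{A_{B}: B\in\beta\}$ and $(A_{B},\Vert\cdot\Vert_{B})$ is complete for every $B\in\beta$. A linear functional $f:A\to\mathbb{C}$ (not assumed continuous) is positive if $f(x^{\ast}x)\geq 0$ for all $x\in A$, hermitian if $f(x^{\ast})=\overline{f(x)}$ for all $x\in A$, and multiplicative if $f(xy)=f(x)f(y)$ for all $x,y\in A$. Extreme points are taken in the algebraic dual $A^{\ast}$ of $A$. *)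

(* Defs.v *)
From HB Require Import structures.
From mathcomp Require Import all_boot all_order all_algebra.
From mathcomp Require Import all_classical all_reals all_analysis.
From mathcomp Require Import complex.

Set Implicit Arguments.
Unset Strict Implicit.
Unset Printing Implicit Defensive.

Import Order.TTheory GRing.Theory Num.Theory.
Import numFieldNormedType.Exports.

Local Open Scope classical_set_scope.
Local Open Scope complex_scope.
Local Open Scope ring_scope.

(* [tvsType] already includes local convexity, but neither the Hausdorff
   property nor a topology-compatible product. [algType] forces 1 != 0; on the
   zero algebra no functional satisfies f 1 = 1 and none is nonzero. *)
HB.mixin Record Tvs_isLocConvAlgebra (K : numDomainType) A
    & GRing.Algebra K A & Tvs K A := {
  lca_mulrl_continuous : forall x : A, continuous (fun y : A => x * y) ;
  lca_mulrr_continuous : forall x : A, continuous (fun y : A => y * x) ;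
  lca_hausdorff : hausdorff_space A
}.

#[short(type="locConvAlgType")]
HB.structure Definition LocConvAlgebra (K : numDomainType) :=
  {A of Tvs K A & GRing.Algebra K A & Tvs_isLocConvAlgebra K A}.

HB.mixin Record LocConvAlgebra_hasInvolution (K : numClosedFieldType) A
    & LocConvAlgebra K A := {
  star : A -> A ;
  starK : involutive star ;
  starD : forall x y : A, star (x + y) = star x + star y ;
  starZ : forall (k : K) (x : A), star (k *: x) = k^* *: star x ;
  starM : forall x y : A, star (x * y) = star y * star x ;
  star_continuous : continuous star
}.

#[short(type="comLocConvStarAlgType")]
HB.structure Definition ComLocConvStarAlgebra (K : numClosedFieldType) :=
  {A of LocConvAlgebra K A & GRing.ComAlgebra K A
      & LocConvAlgebra_hasInvolution K A}.

Section BPstar.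
Context {R : realType} {A : comLocConvStarAlgType R[i]}.
Implicit Types (B : set A) (x y : A).

(* Von Neumann boundedness: [bounded_set] is only available in normed spaces. *)
Definition tvs_bounded B : Prop :=
  forall U : set A, nbhs 0 U ->
    exists2 s : R, 0 < s &
      forall t : R, s < t -> B `<=` [set t%:C *: u | u in U].

Definition absolutely_convex B : Prop :=
  forall x y (a b : R[i]), B x -> B y -> `|a| + `|b| <= 1 ->
    B (a *: x + b *: y).

Definition beta_family : set (set A) := [set B |
  [/\ closed B, tvs_bounded B & absolutely_convex B] /\
  [/\ B 1, star @` B = B & forall x y, B x -> B y -> B (x * y)]].

Definition lin_span B : set A := [set x |
  exists (n : nat) (k : 'I_n -> R[i]) (b : 'I_n -> A),
    (forall i, B (b i)) /\ x = \sum_(i < n) k i *: b i].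

Definition minkowski_functional B x : R :=
  inf [set t : R | 0 < t /\ [set t%:C *: b | b in B] x].

Definition minkowski_complete B : Prop :=
  forall u : nat -> A,
    (forall n, lin_span B (u n)) ->
    (forall e : R, 0 < e -> exists N : nat, forall m n : nat,
       (N <= m)%N -> (N <= n)%N ->
       minkowski_functional B (u m - u n) < e) ->
    exists2 l : A, lin_span B l &
      forall e : R, 0 < e -> exists N : nat, forall n : nat,
        (N <= n)%N -> minkowski_functional B (u n - l) < e.

End BPstar.

Definition BPstar_algebra (R : realType) (A : comLocConvStarAlgType R[i]) :
    Prop :=
  (forall x : A, exists2 B : set A, beta_family B & lin_span B x) /\
  (forall B : set A, beta_family B -> minkowski_complete B).

Local Open Scope convex_scope.

Definition extreme_points (K : numDomainType) (E : lmodType K) (S : set E) :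
    set E :=
  [set x | S x /\
    forall (y z : E) (t : {i01 K}), S y -> S z -> 0 < t%:num -> t%:num < 1 ->
      x = (y : convex_lmodType E) <| t |> (z : convex_lmodType E) ->
      y = x /\ z = x].

(* Functionals are elements of the function space [A -> R[i]^o], of which the
   algebraic dual of [A] is a linear subspace: extremality in a subset of the
   dual does not depend on which of the two is taken as ambient space. *)
Section functionals.
Context {R : realType} (A : comLocConvStarAlgType R[i]).

Definition positive_functional (f : A -> R[i]^o) : Prop :=
  forall x, 0 <= (f (star x * x) : R[i]).

Definition hermitian_functional (f : A -> R[i]^o) : Prop :=
  forall x, f (star x) = (f x : R[i])^*.

Definition multiplicative_functional (f : A -> R[i]^o) : Prop :=
  forall x y, f (x * y) = f x * f y.

Definition P1 : set (A -> R[i]^o) :=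
  [set f | [/\ linear f, positive_functional f & f 1 = 1]].

Definition Ms : set (A -> R[i]^o) :=
  [set f | [/\ linear f, f <> 0, hermitian_functional f
             & multiplicative_functional f]].

Lemma convex_P1 : convex_set P1.
Proof.
move=> f g t; rewrite !inE => -[lf pf f1] [lg pg g1].
have E x : ((f : convex_lmodType _) <| t |> g) x =
  t%:num * f x + (1 - t%:num) * g x by [].
split.
- move=> a x y; rewrite !E lf lg scalerDr !mulrDr !scalerAr.
  exact: addrACA.
- move=> x; by rewrite E; apply: addr_ge0; apply: mulr_ge0.
- by rewrite E f1 g1 !mulr1 addrC subrK.
Qed.

End functionals.

Arguments P1 {R} A _.
Arguments Ms {R} A _.

(* Main.v *)
Require Import Defs.
From mathcomp Require Import all_boot all_order all_algebra.
From mathcomp Require Import all_classical all_reals all_analysis.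
From mathcomp Require Import complex.
From mathcomp Require Import ring lra.

Set Implicit Arguments.
Unset Strict Implicit.
Unset Printing Implicit Defensive.

Import Order.TTheory GRing.Theory Num.Theory.
Import numFieldNormedType.Exports.

Local Open Scope classical_set_scope.
Local Open Scope ring_scope.

(** The proof is algebraic except for one analytic input: in a BP*-algebra,
    [1 - s h] is the square of a hermitian element whenever [h] is hermitian
    and the real number [s] is small enough ([BPstar_square_near_one]).

    For one inclusion, let [f] be hermitian and multiplicative, and write it as
    a proper convex combination of [g] and [g'] in [P1 A]. A positive multiple
    of [g] is then at most [f] on the elements [x* x]. If [f x = 0] then
    [f (x* x) = 0], hence [g (x* x) = 0], and the Cauchy-Schwarz inequality
    gives [g x = 0]. Two functionals with value 1 at the identity are equal as
    soon as one of them vanishes on the kernel of the other, so [g = f]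
    ([Ms_dominates]), and likewise [g' = f].

    For the other inclusion, let [f] be extreme. Take [p] hermitian such that
    [1 - p] and [1 + p] are squares of hermitian elements and [-1 < f p < 1].
    The functionals [x |-> f ((1 - p) x) / f (1 - p)] and
    [x |-> f ((1 + p) x) / f (1 + p)] belong to [P1 A], and [f] is their convex
    combination with weights [(1 - f p) / 2] and [(1 + f p) / 2]. By
    extremality the first one is [f], that is [f (p x) = f p f x]
    ([extreme_mul_square]). By the analytic input, every hermitian element has
    a positive multiple [p] of this kind, and hermitian elements span [A] over
    the complex numbers, so [f] is multiplicative.

    The square root of [1 - h] is [1 - l], where [l] is a fixed point of
    [y |-> (h + y^2) / 2]. When [h] lies in [B / 2], this map contracts [B / 2]
    for the Minkowski functional of [B], and completeness of the span of [B]
    provides the fixed point ([one_sub_square]). *)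

(** * Involution *)

Lemma conj_realc (R : realType) (a : R) : (a%:C%C : R[i])^* = a%:C%C.
Proof. by apply/eqP; rewrite eq_complex /= oppr0 !eqxx. Qed.

Section Star.
Context {K : numClosedFieldType} {A : comLocConvStarAlgType K}.
Implicit Types (x y : A) (k : K).

Lemma star1 : star 1 = 1 :> A.
Proof. by rewrite -[RHS]starK -[in RHS](mulr1 (star 1)) starM starK mulr1. Qed.

Lemma starN x : star (- x) = - star x.
Proof. by rewrite -scaleN1r starZ rmorphN1 scaleN1r. Qed.

Lemma starB x y : star (x - y) = star x - star y.
Proof. by rewrite starD starN. Qed.

Lemma star_shift k x :
  star (x + k *: 1) * (x + k *: 1) =
  star x * x + k *: star x + k^* *: x + (k^* * k) *: 1.
Proof.
rewrite starD starZ star1 mulrDl !mulrDr -!scalerAl -!scalerAr !mul1r !mulr1.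
by rewrite scalerA !addrA.
Qed.

Lemma hermitian_decomposition x :
  exists h l : A, [/\ star h = h, star l = l & x = h + 'i *: l].
Proof.
pose c : K := 2^-1; pose d : K := - (c * 'i).
have c_real : c^* = c by rewrite fmorphV rmorph_nat.
have d_imag : d^* = - d by rewrite rmorphN rmorphM /= c_real conjCi mulrN.
have id_c : 'i * d = c by rewrite mulrN mulrCA -expr2 sqrCi mulrN1 opprK.
exists (c *: (x + star x)), (d *: (x - star x)); split.
- by rewrite starZ starD starK c_real addrC.
- by rewrite starZ starB starK d_imag scaleNr -scalerN opprB.
- rewrite scalerA id_c -scalerDr addrACA subrr addr0 -mulr2n.
  by rewrite -scaler_nat scalerA mulVf ?scale1r // pnatr_eq0.
Qed.

End Star.

(** * Positive functionals and multiplicative functionals *)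

Section Functionals.
Context {R : realType} {A : comLocConvStarAlgType R[i]}.
Local Notation C := R[i].
Implicit Types (f g : A -> C^o) (x y : A) (k : C).

Section Linear.
Variables (f : A -> C^o) (lin_f : linear f).

Lemma functionalD x y : f (x + y) = (f x : C) + f y.
Proof. by rewrite -[x in LHS]scale1r lin_f scale1r. Qed.

Lemma functional0 : f 0 = 0.
Proof.
by apply: (addrI (f 0 : C)); rewrite -functionalD !addr0.
Qed.

Lemma functionalZ k x : f (k *: x) = k * (f x : C).
Proof. by rewrite -[k *: x]addr0 lin_f functional0 addr0. Qed.

Lemma functionalB x y : f (x - y) = (f x : C) - f y.
Proof. by rewrite functionalD -scaleN1r functionalZ mulN1r. Qed.

End Linear.

(** The cross term [k f(x* ) + conj(k) f(x)] of [f ((x + k)* (x + k))] is real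
    for every scalar [k]; the cases [k = 1] and [k = 'i] suffice. *)
Lemma positive_hermitian f :
  linear f -> positive_functional f -> hermitian_functional f.
Proof.
move=> lf pf x; have fr y : (f (star y * y) : C) \is Num.real.
  by apply: ger0_real; apply: pf.
have f1r : (f 1 : C) \is Num.real by rewrite -[1]mulr1 -{1}star1.
have cross k : k * (f (star x) : C) + k^* * f x \is Num.real.
  have := fr (x + k *: 1).
  rewrite star_shift !(functionalD lf) !(functionalZ lf).
  move=> /(realB (fr x)) H.
  have kk : k^* * k * (f 1 : C) \is Num.real.
    by rewrite realM // mulrC -normCK realX.
  have -> : k * (f (star x) : C) + k^* * f x =
    - ((f (star x * x) : C) - (f (star x * x) + k * f (star x) + k^* * f x
       + k^* * k * f 1)) - k^* * k * f 1 by ring.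
  by rewrite realB // realN.
have /CrealP := cross 1; have /CrealP := cross 'i.
rewrite !rmorphD !rmorphM /= conjCK conjCi rmorph1 !mul1r.
set u := (f (star x) : C); set v := (f x : C) => Hi H1.
have {}Hi : v^* - u^* = u - v.
  apply: (mulfI (neq0Ci C)).
  by rewrite !mulrBr -[- ('i * v)]mulNr -Hi mulNr addrC.
have : 2 * u = 2 * v^*.
  have -> : 2 * u = (u + v) + (u - v) by ring.
  by rewrite -H1 -Hi; ring.
by move=> /(mulfI _) ->; rewrite // pnatr_eq0.
Qed.

(** The difference of the two sides is the variance of [x] under [f], that is
    the value of [f] at [(x - f x)* (x - f x)]. *)
Lemma P1_cauchy_schwarz f x :
  P1 A f -> (f x : C) * (f x : C)^* <= (f (star x * x) : C).
Proof.
move=> [lf pf f1]; have := pf (x + (- (f x : C)) *: 1).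
rewrite star_shift !(functionalD lf) !(functionalZ lf) f1 mulr1.
rewrite (positive_hermitian lf pf) rmorphN /= => var_ge0.
rewrite -subr_ge0; apply: (le_trans var_ge0).
by rewrite le_eqVlt; apply/orP; left; apply/eqP; ring.
Qed.

Lemma P1_nonneg_square f y d : P1 A f -> star d = d -> d * d = y ->
  0 <= (f y : C).
Proof. by move=> [_ pf _] sd <-; rewrite -{1}sd; apply: pf. Qed.

Lemma Ms1 f : Ms A f -> f 1 = 1.
Proof.
move=> [lf fn0 _ mf]; have := mf 1 1; rewrite mulr1.
have [f10|f1n0] := eqVneq (f 1 : C) 0.
  move=> _; case: fn0; apply/funext => x.
  by rewrite -[x]mulr1 mf f10 mulr0.
by rewrite -{1}[f 1]mulr1 => /(mulfI f1n0).
Qed.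

Lemma Ms_P1 f : Ms A f -> P1 A f.
Proof.
move=> Msf; have [lf _ hf mf] := Msf; split => //; last exact: Ms1.
by move=> x; rewrite mf hf mulrC mul_conjC_ge0.
Qed.

(** By Cauchy-Schwarz, [g] vanishes on the kernel of [f], which contains
    [x - f x] for every [x]. *)
Lemma Ms_dominates f g (c : C) : Ms A f -> P1 A g -> 0 < c ->
  (forall x, c * (g (star x * x) : C) <= (f (star x * x) : C)) -> g = f.
Proof.
move=> Msf P1g c0 gf; have [lf _ hf mf] := Msf; have [lg pg g1] := P1g.
have g_ker x : f x = 0 -> g x = 0.
  move=> fx0; have := gf x; rewrite mf fx0 mulr0 pmulr_rle0 // => gxx.
  have := le_trans (P1_cauchy_schwarz x P1g) gxx => gx0.
  apply/eqP; rewrite -mul_conjC_eq0 eq_le gx0.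
  exact: mul_conjC_ge0.
apply/funext => x.
have := g_ker (x - (f x : C) *: 1).
rewrite !(functionalB lf) !(functionalB lg) (functionalZ lf) (functionalZ lg).
rewrite (Ms1 Msf) g1 !mulr1 subrr => /(_ erefl) /eqP.
by rewrite subr_eq0 => /eqP.
Qed.

End Functionals.

(** * Multiples of a set of the family, and square roots *)

Section Disk.
Context {R : realType} {A : comLocConvStarAlgType R[i]}.
Variable B : set A.
Hypothesis betaB : beta_family B.
Implicit Types (a b c d e t : R) (x y h : A).

(** For [0 < t], the ball of radius [t] of the span of [B]. Working with these
    sets avoids manipulating the infimum in the Minkowski functional. *)
Definition disk t : set A := [set t%:C%C *: b | b in B].

Lemma normc_real a : `|a%:C%C| = `|a|%:C%C :> R[i].
Proof. by rewrite normc_def /= expr0n addr0 sqrtr_sqr. Qed.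

Lemma disk_comb a b c d e x y : 0 <= c -> 0 <= d -> 0 < e ->
  `|a| * c + `|b| * d <= e -> disk c x -> disk d y ->
  disk e (a%:C%C *: x + b%:C%C *: y).
Proof.
have [[_ _ acB] _] := betaB => c0 d0 e0 le_e [u Bu <-] [v Bv <-].
exists ((a * c / e)%:C%C *: u + (b * d / e)%:C%C *: v).
  apply: acB => //; rewrite !normc_real -rmorphD lecR !normrM !normfV.
  rewrite (ger0_norm c0) (ger0_norm d0) (gtr0_norm e0) -mulrDl.
  by rewrite ler_pdivrMr // mul1r.
rewrite scalerDr !scalerA -!rmorphM.
by congr (_%:C%C *: _ + _%:C%C *: _); rewrite mulrC divfK // gt_eqF.
Qed.

Lemma disk_mul c d x y : disk c x -> disk d y -> disk (c * d) (x * y).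
Proof.
have [_ [_ _ BB]] := betaB => -[u Bu <-] [v Bv <-].
exists (u * v); first exact: BB.
by rewrite -scalerAl -scalerAr scalerA rmorphM.
Qed.

Lemma disk_star c x : disk c x -> disk c (star x).
Proof.
have [_ [_ sB _]] := betaB => -[u Bu <-]; exists (star u).
  by rewrite -sB; exists u.
by rewrite starZ conj_realc.
Qed.

Lemma disk_add c d e x y : 0 <= c -> 0 <= d -> 0 < e -> c + d <= e ->
  disk c x -> disk d y -> disk e (x + y).
Proof.
move=> c0 d0 e0 le_e cx dy; rewrite -[x]scale1r -[y]scale1r.
by apply: (disk_comb c0 d0) => //; rewrite normr1 !mul1r.
Qed.

Lemma disk_scale a c e x : 0 <= c -> 0 < e -> `|a| * c <= e ->
  disk c x -> disk e (a%:C%C *: x).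
Proof.
move=> c0 e0 le_e cx; rewrite -[_ *: x]addr0 -(scale0r x).
by apply: (disk_comb c0 c0) => //; rewrite normr0 mul0r addr0.
Qed.

Lemma disk_sub c d e x y : 0 <= c -> 0 < d -> 0 < e -> c + d <= e ->
  disk c x -> disk d y -> disk e (x - y).
Proof.
move=> c0 d0 e0 le_e cx dy.
apply: (disk_add c0 (ltW d0)) => //.
rewrite -scaleN1r -(rmorphN1 (real_complex R)).
by apply: (disk_scale (ltW d0)) => //; rewrite normrN normr1 mul1r.
Qed.

(** The Minkowski functional is a norm: a bounded set is absorbed by the
    complement of [x], a neighborhood of 0 when [x] is nonzero. *)
Lemma disk_sep x : (forall e, 0 < e -> disk e x) -> x = 0.
Proof.
have [[_ bB _] _] := betaB => small.
apply/eqP; apply/negPn/negP => x0.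
have nbhs0 : nbhs 0 (~` [set x]).
  apply: open_nbhs_nbhs; split; last first.
    by move=> /= /eqP; rewrite eq_sym; apply/negP.
  rewrite openC; apply: accessible_closed_set1; apply: hausdorff_accessible.
  exact: lca_hausdorff.
have [s s0 absorb] := bB _ nbhs0.
have t0 : 0 < s + 1 by rewrite ltr_wpDl // ltW.
have ti0 : 0 < (s + 1)^-1 by rewrite invr_gt0.
have [b Bb xb] := small _ ti0.
have [|u xu bu] := absorb (s + 1) _ b Bb; first by rewrite ltrDl.
apply: xu => /=; rewrite -xb -bu scalerA -rmorphM mulVf ?scale1r //.
by rewrite gt_eqF.
Qed.

Lemma span_disk x : lin_span B x -> exists2 c : R, 0 < c & disk c x.
Proof.
have [[_ _ acB] [B1 _ _]] := betaB.
move=> [n [k [b [Bb ->]]]].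
apply: (big_ind (fun y => exists2 c : R, 0 < c & disk c y)).
- exists 1 => //; exists 0; last by rewrite scaler0.
  have := acB 1 1 0 0 B1 B1; rewrite !scale0r addr0; apply.
  by rewrite normr0 addr0 ler01.
- move=> y z [c c0 cy] [d d0 dz]; exists (c + d); first exact: addr_gt0.
  by apply: (disk_add (ltW c0) (ltW d0)) => //; apply: addr_gt0.
- move=> i _.
  (* adding 1 keeps the radius positive when the coefficient is 0 *)
  pose c := complex.Re `|k i| + 1.
  have cE : `|k i| + 1 = c%:C%C by rewrite /c normc_def rmorphD.
  have c0 : 0 < c by rewrite -ltcR -cE ltr_wpDl.
  exists c => //; exists ((k i / c%:C%C) *: b i + 0 *: b i).
    apply: acB => //; rewrite normr0 addr0 normrM normfV normc_real.
    rewrite (gtr0_norm c0) ler_pdivrMr ?ltcR // mul1r -cE lerDl.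
    exact: ler01.
  rewrite scale0r addr0 scalerA mulrC divfK //.
  by rewrite gt_eqF // ltcR.
Qed.

Lemma disk_span t x : disk t x -> lin_span B x.
Proof.
move=> [b Bb <-]; exists 1%N, (fun=> t%:C%C), (fun=> b); split => //.
by rewrite big_ord1.
Qed.

Lemma minkowski_disk e x : lin_span B x -> minkowski_functional B x < e ->
  disk e x.
Proof.
move=> /span_disk [c c0 cx] /inf_lt[|t [t0 tx] lt_te]; first by exists c.
rewrite -[x]scale1r; apply: (disk_scale (ltW t0)) tx.
  exact: lt_trans lt_te.
by rewrite normr1 mul1r ltW.
Qed.

Lemma disk_minkowski t x : 0 < t -> disk t x -> minkowski_functional B x <= t.
Proof.
move=> t0 tx; apply: ge_inf; last by split.
by exists 0 => s [/ltW].
Qed.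

Section SquareRoot.
Hypothesis completeB : minkowski_complete B.
Variable h : A.
Hypotheses (h_small : disk 2^-1 h) (h_herm : star h = h).

(** Successive approximations of the solution of [l = (h + l^2) / 2], for which
    [(1 - l)^2 = 1 - h]. *)
Let u n : A := iter n (fun y => (2^-1)%:C%C *: (h + y * y)) 0.

Let u_star n : star (u n) = u n.
Proof.
elim: n => [|n IHn] /=; first by rewrite -(scale0r 1) starZ rmorph0 !scale0r.
by rewrite starZ conj_realc starD starM h_herm IHn.
Qed.

Let u_disk n : disk 2^-1 (u n).
Proof.
elim: n => [|n IHn] /=.
  rewrite -(scale0r h); apply: disk_scale h_small => //.
  by rewrite normr0 mul0r invr_ge0.
rewrite scalerDr; apply: disk_comb h_small (disk_mul IHn IHn); try lra.
by rewrite ger0_norm; lra.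
Qed.

Let halfD x : (2^-1)%:C%C *: (x + x) = x.
Proof.
have -> : x + x = (2 : R)%:C%C *: x by rewrite rmorph_nat scaler_nat.
by rewrite scalerA -rmorphM mulVf ?scale1r // pnatr_eq0.
Qed.

(** Induction on [n]: by commutativity
    [y^2 / 2 - z^2 / 2 = (y - z) (y + z) / 2], and [y + z] lies in [B] when [y]
    and [z] lie in [B / 2]. So each iteration halves the distance. *)
Let u_cauchy n k : disk (2^-1 ^+ n) (u (n + k)%N - u n).
Proof.
elim: n => [|n IHn].
  rewrite expr0 subr0 -[u _]scale1r; apply: disk_scale (u_disk _) => //;
    by rewrite ?normr1; lra.
have -> : u (n.+1 + k)%N - u n.+1 =
    (2^-1)%:C%C *: ((u (n + k)%N - u n) * (u (n + k)%N + u n)).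
  rewrite addSn /= -scalerBr; congr (_ *: _); ring.
have p0 : 0 < 2^-1 ^+ n :> R by rewrite exprn_gt0.
apply: disk_scale (disk_mul IHn (disk_add _ _ _ _ (u_disk _) (u_disk _)));
  last first.
- exact: (lexx (2^-1 + 2^-1)).
- lra.
- lra.
- lra.
- by rewrite ger0_norm; last lra; rewrite exprS; nra.
- by rewrite exprn_gt0.
- nra.
Qed.

Let small_power e : 0 < e -> exists N, 2^-1 ^+ N < e.
Proof.
move=> e0; exists (Num.bound e^-1); rewrite exprVn -[ltRHS]invrK.
rewrite ltf_pV2 ?posrE ?exprn_gt0 ?invr_gt0 //.
apply: (lt_trans (archi_boundP _)); first by rewrite invr_ge0 ltW.
by rewrite -natrX ltr_nat ltn_expl.
Qed.

(** The completeness hypothesis gives a limit [l] of the approximations for the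
    Minkowski functional. Both [star l - l] and [l - (h + l^2) / 2] have
    arbitrarily small Minkowski functional, hence vanish. *)
Lemma one_sub_square : exists2 d, star d = d & d * d = 1 - h.
Proof.
have [n|e e0|l l_span u_cvg] := completeB (u := u).
- exact: disk_span (u_disk n).
- have [N ltN] := small_power e0; exists N.+1 => m n leN_m leN_n.
  apply: le_lt_trans ltN; apply: disk_minkowski; first by rewrite exprn_gt0.
  have -> : u m - u n = (u m - u N.+1) - (u n - u N.+1) by ring.
  have p0 : 0 < 2^-1 ^+ N :> R by rewrite exprn_gt0.
  rewrite -(subnKC leN_m) -(subnKC leN_n).
  by apply: disk_sub (u_cauchy _ _) (u_cauchy _ _) => //; rewrite exprS; lra.
have u_lim e : 0 < e -> exists n, disk e (u n - l) /\ disk e (u n.+1 - l).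
  move=> e0; have [N HN] := u_cvg _ e0; exists N.
  have span_sub n : lin_span B (u n - l).
    have [c c0 cl] := span_disk l_span.
    by apply: (@disk_span (2^-1 + c)); apply: disk_sub (u_disk n) cl; lra.
  by split; apply: minkowski_disk => //; apply: HN.
have l_disk : disk 1 l.
  have [|n [ul _]] := u_lim 2^-1; first by [].
  have -> : l = u n - (u n - l) by ring.
  by apply: disk_sub (u_disk n) ul; lra.
have l_star : star l = l.
  apply/eqP; rewrite -subr_eq0; apply/eqP; apply: disk_sep => e e0.
  have [|n [ul _]] := u_lim (e / 2); first by lra.
  have -> : star l - l = (u n - l) - star (u n - l).
    by rewrite starB u_star; ring.
  by apply: disk_sub ul (disk_star ul); lra.
have l_fix : l = (2^-1)%:C%C *: (h + l * l).
  apply/eqP; rewrite -subr_eq0; apply/eqP; apply: disk_sep => e e0.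
  have [|n [ul uSl]] := u_lim (e / 2); first by lra.
  have -> : l - (2^-1)%:C%C *: (h + l * l) =
      (2^-1)%:C%C *: ((u n - l) * (u n + l)) - (u n.+1 - l).
    have -> : (u n - l) * (u n + l) = (h + u n * u n) - (h + l * l) by ring.
    by rewrite scalerBr /=; ring.
  have sum_disk : disk (2^-1 + 1) (u n + l).
    by apply: disk_add (u_disk n) l_disk; lra.
  have prod_disk := disk_mul ul sum_disk.
  have half_disk : disk (e / 2) ((2^-1)%:C%C *: ((u n - l) * (u n + l))).
    by apply: disk_scale prod_disk; rewrite ?ger0_norm; lra.
  by apply: disk_sub half_disk uSl; lra.
exists (1 - l); first by rewrite starB star1 l_star.
have l2 : l + l = h + l * l.
  by rewrite {1 2}l_fix -scalerDr halfD.
have -> : (1 - l) * (1 - l) = 1 - (l + l) + l * l by ring.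
by rewrite l2; ring.
Qed.

End SquareRoot.
End Disk.

(** * Extreme points *)

Section Extreme.
Context {R : realType} {A : comLocConvStarAlgType R[i]}.
Local Notation C := R[i].
Implicit Types (f : A -> C^o) (x h p : A).

(** This makes the identity an order unit for the hermitian elements: every
    positive functional is bounded on [h] by a multiple of its value at 1. *)
Lemma BPstar_square_near_one h : BPstar_algebra A -> star h = h ->
  exists2 r : R, 0 < r & forall s : R, `|s| <= r ->
    exists2 d : A, star d = d & d * d = 1 - s%:C%C *: h.
Proof.
move=> [covered complete] h_herm.
have [B betaB /(span_disk betaB) [c c0 ch]] := covered h.
exists (2 * c)^-1; first by rewrite invr_gt0 mulr_gt0.
move=> s le_s; apply: (one_sub_square betaB (complete B betaB)).
  apply: (disk_scale betaB (ltW c0)) ch => //.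
  by rewrite -ler_pdivlMr // -invfM.
by rewrite starZ h_herm conj_realc.
Qed.

(** Positivity: [q x* x = (d x)* (d x)], by commutativity. *)
Lemma P1_cutdown f q d : P1 A f -> star d = d -> d * d = q ->
  0 < (f q : C) -> P1 A (fun x => (f q : C)^-1 * (f (q * x) : C)).
Proof.
move=> [lf pf f1] d_herm dq fq; split.
- move=> a x y /=; rewrite mulrDr -scalerAr (functionalD lf) (functionalZ lf).
  by rewrite mulrDr [in RHS]/GRing.scale /= mulrCA.
- move=> x; apply: mulr_ge0; first by rewrite invr_ge0 ltW.
  have -> : q * (star x * x) = star (d * x) * (d * x).
    by rewrite -dq starM d_herm; ring.
  exact: pf.
- by rewrite mulr1 mulVf // gt_eqF.
Qed.

(** [f] is the convex combination, with weights [(1 - f p) / 2] and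
    [(1 + f p) / 2], of its normalized cutdowns by [1 - p] and [1 + p]. *)
Lemma extreme_mul_square f p x (d d' : A) :
  extreme_points (P1 A) f ->
  star d = d -> d * d = 1 - p -> star d' = d' -> d' * d' = 1 + p ->
  0 < 1 - (f p : C) -> 0 < 1 + (f p : C) ->
  f (p * x) = (f p : C) * f x.
Proof.
move=> [P1f ext_f] d_herm dp d'_herm d'p f_lt1 f_gtN1; have [lf _ f1] := P1f.
have fm : (f (1 - p) : C) = 1 - f p by rewrite (functionalB lf) f1.
have fP : (f (1 + p) : C) = 1 + f p by rewrite (functionalD lf) f1.
have fmM y : (f ((1 - p) * y) : C) = (f y : C) - f (p * y).
  by rewrite mulrBl mul1r (functionalB lf).
have fPM y : (f ((1 + p) * y) : C) = (f y : C) + f (p * y).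
  by rewrite mulrDl mul1r (functionalD lf).
have [fm_gt0 fP_gt0] : 0 < (f (1 - p) : C) /\ 0 < (f (1 + p) : C).
  by rewrite fm fP.
have P1m := P1_cutdown P1f d_herm dp fm_gt0.
have P1p := P1_cutdown P1f d'_herm d'p fP_gt0.
set t0 : C := (1 - (f p : C)) / 2.
have two0 : (2 : C) != 0 by rewrite pnatr_eq0.
have t0C : 1 - t0 = (1 + (f p : C)) / 2 by rewrite /t0; field.
have t0_gt0 : 0 < t0 by rewrite divr_gt0.
have t0_lt1 : t0 < 1 by rewrite -subr_gt0 t0C divr_gt0.
pose t := Itv01 (ltW t0_gt0) (ltW t0_lt1).
have [|gf _] := ext_f _ _ t P1m P1p t0_gt0 t0_lt1.
  apply/funext => y.
  suff : (f y : C) = t0 * ((f (1 - p) : C)^-1 * (f ((1 - p) * y) : C)) +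
    (1 - t0) * ((f (1 + p) : C)^-1 * (f ((1 + p) * y) : C)) by [].
  rewrite t0C fm fP fmM fPM /t0.
  by field; rewrite !gt_eqF.
have /(congr1 (fun g => g x)) /= := gf.
rewrite fm fmM => E.
have : (f x : C) - f (p * x) = (1 - f p) * f x.
  by rewrite -[in RHS]E mulVKf // gt_eqF.
by rewrite mulrBl mul1r => /addrI /oppr_inj.
Qed.

(** Rescale [h] to [p = r h / 2]. The factor 1/2 makes [1 - 2 p] and [1 + 2 p]
    squares as well, whence [-1/2 <= f p <= 1/2] and both weights in
    [extreme_mul_square] are positive. *)
Lemma extreme_mul_hermitian f h x : BPstar_algebra A ->
  extreme_points (P1 A) f -> star h = h -> f (h * x) = (f h : C) * f x.
Proof.
move=> bpA ext_f h_herm; have [P1f _] := ext_f; have [lf _ f1] := P1f.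
have [r r0 sq] := BPstar_square_near_one bpA h_herm.
pose p : A := (r / 2)%:C%C *: h.
have r2 : (r / 2)%:C%C != 0 :> C by rewrite gt_eqF // ltcR divr_gt0.
suff fp : f (p * x) = (f p : C) * f x.
  move: fp; rewrite -scalerAl !(functionalZ lf) -mulrA.
  by move=> /(mulfI r2).
have bound s : `|s| <= r -> 0 <= 1 - s%:C%C * (f h : C).
  move=> /sq [d d_herm dq]; have := P1_nonneg_square P1f d_herm dq.
  by rewrite (functionalB lf) (functionalZ lf) f1.
have [|d d_herm dp] := sq (r / 2); first by rewrite ger0_norm; lra.
have [|d' d'_herm d'p] := sq (- (r / 2)).
  by rewrite normrN ger0_norm; lra.
have fpE : (r / 2)%:C%C * (f h : C) = f p by rewrite functionalZ.
have rE : (r%:C%C : C) = 2 * (r / 2)%:C%C.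
  by rewrite -(rmorph_nat (real_complex R)) -rmorphM /= mulrC divfK.
apply: (@extreme_mul_square f p x d d') => //.
- by rewrite d'p rmorphN /= scaleNr opprK.
- rewrite -(pmulr_rgt0 _ (ltr0n C 2)).
  have -> : 2 * (1 - (f p : C)) = 1 + (1 - r%:C%C * (f h : C)).
    by rewrite -fpE rE; ring.
  by rewrite ltr_pwDl // bound // gtr0_norm.
- rewrite -(pmulr_rgt0 _ (ltr0n C 2)).
  have -> : 2 * (1 + (f p : C)) = 1 + (1 - (- r)%:C%C * (f h : C)).
    by rewrite -fpE rmorphN /= rE; ring.
  by rewrite ltr_pwDl // bound // normrN gtr0_norm.
Qed.

End Extreme.

Theorem theorem2 (R : realType) (A : comLocConvStarAlgType R[i]) :
  BPstar_algebra A -> extreme_points (P1 A) = Ms A.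
Proof.
move=> bpA; apply/seteqP; split => f.
- move=> ext_f; have [[lf pf f1] _] := ext_f; split => //.
  + move=> f0; move/eqP: f1; rewrite f0.
    by rewrite eq_sym oner_eq0.
  + exact: positive_hermitian.
  + move=> x y; have [h [l [h_herm l_herm ->]]] := hermitian_decomposition x.
    rewrite mulrDl -scalerAl !(functionalD lf) !(functionalZ lf).
    rewrite !(extreme_mul_hermitian _ bpA ext_f) //.
    by rewrite mulrDl mulrA.
- move=> Msf; split; first exact: Ms_P1.
  move=> g g' t P1g P1g' t0 t1 fE.
  have fxE x : (f x : R[i]) = t%:num * g x + (1 - t%:num) * g' x by rewrite fE.
  have t'0 : 0 < 1 - t%:num by rewrite subr_gt0.
  have [[_ pg _] [_ pg' _]] := (P1g, P1g').
  split.
  + apply: (Ms_dominates Msf P1g t0) => x.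
    by rewrite fxE lerDl mulr_ge0 // ltW.
  + apply: (Ms_dominates Msf P1g' t'0) => x.
    by rewrite fxE lerDr mulr_ge0 // ltW.
Qed.
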